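(* Let $s\geq 8$ and let $\mathbb{X}\subset \mathbb{P}^2_k$ be an $(s-2)$-fold collinear configuration of $s$ distinct points. Then the Jacobian ideal of $I(\mathbb{X})$ is not $\mathcal{VV}$-torsion free.
   Context: $k$ is an algebraically closed field of characteristic zero and $R=k[x,y,z]$ is the homogeneous coordinate ring of $\mathbb{P}^2_k$. Configuration: given integers $s\geq 4$ and $0\leq r\leq s-3$, an $(s-r)$-fold collinear configuration is a set of $s$ distinct points of $\mathbb{P}^2_k$ such that exactly $s-r$ of them lie on a straight line (i.e. there is a line containing exactly $s-r$ of the points). For a finite set $\mathbb{X}$ of distinct points, $J=I(\mathbb{X})\subset R$ is its (radical) homogeneous defining ideal. Let $\Theta$ be the Jacobian matrix of a set of homogeneous generators of $J$, and $I_2(\Theta)\subset R$ the ideal generated by its $2\times 2$ minors. Put $I=(J,I_2(\Theta))\subset R$; the Jacobian ideal of $I(\mathbb{X})$ is $I$ (equivalently its image $I/J$ in $R/J$); it does not depend on the choice of generators. The Jacobian ideal is called $\mathcal{VV}$-torsion free if the Valabrega--Valla module $\bigoplus_{t\ge 2}\frac{J\cap I^t}{J I^{t-1}}$ is zero, i.e. if $J\cap I^t=JI^{t-1}$ for all $t\geq 2$. *)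

(* Defs.v *)
From HB Require Import structures.
From mathcomp Require Import all_boot all_order all_algebra.
From mathcomp Require Export mpoly.

Set Implicit Arguments.
Unset Strict Implicit.
Unset Printing Implicit Defensive.

Import GRing.Theory.
Local Open Scope ring_scope.

Definition ideal_gen (R : comNzRingType) (S : R -> Prop) : R -> Prop :=
  fun f => exists (n : nat) (a g : 'I_n -> R),
    (forall i, S (g i)) /\ f = \sum_(i < n) a i * g i.

Definition ideal_mul (R : comNzRingType) (I J : R -> Prop) : R -> Prop :=
  ideal_gen (fun h => exists f g : R, [/\ I f, J g & h = f * g]).

Fixpoint ideal_exp (R : comNzRingType) (I : R -> Prop) (t : nat) : R -> Prop :=
  if t is t'.+1 then ideal_mul I (ideal_exp I t') else fun _ => True.

Definition VV_torsion_free (R : comNzRingType) (J I : R -> Prop) : Prop :=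
  forall t : nat, (2 <= t)%N ->
  forall f : R, (J f /\ ideal_exp I t f) <-> ideal_mul J (ideal_exp I t.-1) f.

(* A point of P^2 is represented by a nonzero vector of homogeneous
   coordinates; two such vectors represent the same point when [proj_eq]
   holds. *)
Definition proj_eq (k : fieldType) (u v : 'rV[k]_3) : Prop :=
  exists2 c : k, c != 0 & u = c *: v.

Definition distinct_points (k : fieldType) (s : nat) (X : 'I_s -> 'rV[k]_3)
    : Prop :=
  (forall i, X i != 0) /\ (forall i j, i != j -> ~ proj_eq (X i) (X j)).

(* The line with equation l_0 x + l_1 y + l_2 z = 0 is given by the nonzero
   column l. *)
Definition collinear_configuration (k : fieldType) (s r : nat)
    (X : 'I_s -> 'rV[k]_3) : Prop :=
  [/\ (4 <= s)%N, (r <= s - 3)%N, distinct_points X &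
      exists2 l : 'cV[k]_3, l != 0 & #|[set i | X i *m l == 0]| = (s - r)%N].

Definition homogeneous (k : fieldType) (f : {mpoly k[3]}) : Prop :=
  exists d : nat, f \is d.-homog.

(* Vanishing of a form at a point does not depend on the chosen coordinate
   vector. *)
Definition vanishing_ideal (k : fieldType) (s : nat) (X : 'I_s -> 'rV[k]_3)
    : {mpoly k[3]} -> Prop :=
  ideal_gen (fun f : {mpoly k[3]} =>
    homogeneous f /\ forall i, f.@[X i 0] = 0).

Definition homogeneous_generators (k : fieldType) (J : {mpoly k[3]} -> Prop)
    (m : nat) (g : 'I_m -> {mpoly k[3]}) : Prop :=
  (forall i, homogeneous (g i)) /\
  (forall f, J f <-> ideal_gen (fun h => exists i, h = g i) f).

Definition jacobian_matrix (k : fieldType) (m : nat)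
    (g : 'I_m -> {mpoly k[3]}) : 'M[{mpoly k[3]}]_(m, 3) :=
  \matrix_(i < m, j < 3) (g i)^`M(j).

Definition minor_ideal (R : comNzRingType) (p m n : nat) (A : 'M[R]_(m, n))
    : R -> Prop :=
  ideal_gen (fun h => exists (a : 'I_p -> 'I_m) (b : 'I_p -> 'I_n),
    [/\ {homo a : i j / (i < j)%N}, {homo b : i j / (i < j)%N} &
        h = \det (mxsub a b A)]).

Definition jacobian_ideal (k : fieldType) (J : {mpoly k[3]} -> Prop) (m : nat)
    (g : 'I_m -> {mpoly k[3]}) : {mpoly k[3]} -> Prop :=
  ideal_gen (fun f => J f \/ minor_ideal 2 (jacobian_matrix g) f).

(* Main.v *)
Require Import Defs.
From HB Require Import structures.
From mathcomp Require Import all_boot all_order all_algebra mpoly.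
From mathcomp Require Import ring.

Set Implicit Arguments.
Unset Strict Implicit.
Unset Printing Implicit Defensive.

Import GRing.Theory.
Local Open Scope ring_scope.

(** Let [n = s - 2 >= 6] be the number of points on the line [z = 0], let [P]
    and [Q] be the two other points, [y] the equation of the line [PQ], and [x]
    a linear form that vanishes at [P], agrees with [z] at [Q] and vanishes at
    no point of the configuration on [z = 0] ([adapted_forms]). The points on
    this line are then [(1 : b : 0)] for [n] distinct values [b]. Let
    [F = \prod_b (y - b x)] be the cone over them with vertex [P]. Subtracting a
    multiple of [z^2 x^(n-2)] makes it vanish at [Q] and gives a form [G] of the
    ideal [J] of the points, which also contains [y z] and [z x (x - z)].

    The 2 x 2 minors of the gradients of these three forms show that the
    Jacobian ideal [I] contains [z x^2], [z^2 x] and, writing [u] and [v] for the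
    partial derivatives of [F] in [x] and [y], also [y u], [y v], [x^2 u] and
    [x^2 v]. Hence [(x,y)^4 (u,v)^2] is contained in [I^2]. Let [H] be the
    hessian of [F]. By Euler's relations,

      [n F H = (n - 1) (F_yy u^2 - 2 F_xy u v + F_xx v^2)],

    and the second partial derivatives are of degree [n - 2 >= 4]: this is where
    eight points are needed. So [F H] is in [I^2], and [G H] is in [J] and in
    [I^2] ([jac_sq_hessian]).

    On the other hand [G H] is not in [J I]. Restricted to the line [z = 0], the
    ideal [J] lands in the multiples of the binary form [F], and [I] in the ideal
    [(u, v)] of its partial derivatives ([restr_jacobian_ideal]), while [G]
    becomes [F]. If [G H] were in [J I], cancelling [F] would give a hessian in
    [(u, v)]. But in characteristic zero the hessian of a squarefree binary form
    is never in the ideal of the partial derivatives ([hessian_notin_partials]).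
    Thus the Valabrega-Valla module is nonzero in its component [t = 2]. *)

(** * Ideals *)

Definition is_ideal (R : comNzRingType) (I : R -> Prop) : Prop :=
  [/\ I 0, (forall f g, I f -> I g -> I (f + g))
    & forall a f, I f -> I (a * f)].

Section Ideals.
Variable R : comNzRingType.
Implicit Types (I J S : R -> Prop) (f g : R).

Lemma ideal_zero I : is_ideal I -> I 0. Proof. by case. Qed.

Lemma ideal_add I f g : is_ideal I -> I f -> I g -> I (f + g).
Proof. by case=> _ ID _; apply: ID. Qed.

Lemma ideal_mull I a f : is_ideal I -> I f -> I (a * f).
Proof. by case=> _ _ IM; apply: IM. Qed.

Lemma ideal_mulr I a f : is_ideal I -> I f -> I (f * a).
Proof. by rewrite mulrC; apply: ideal_mull. Qed.

Lemma ideal_opp I f : is_ideal I -> I f -> I (- f).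
Proof. by move=> idI If; rewrite -mulN1r; apply: ideal_mull. Qed.

Lemma ideal_sub I f g : is_ideal I -> I f -> I g -> I (f - g).
Proof. by move=> idI If Ig; apply: ideal_add => //; apply: ideal_opp. Qed.

Lemma ideal_sum I (T : Type) (r : seq T) (P : pred T) (F : T -> R) :
  is_ideal I -> (forall i, P i -> I (F i)) -> I (\sum_(i <- r | P i) F i).
Proof.
by move=> idI IF; apply: (big_ind I) => //; [apply: ideal_zero | move=> *; apply: ideal_add].
Qed.

Lemma ideal_gen_min S I f :
  is_ideal I -> (forall g, S g -> I g) -> ideal_gen S f -> I f.
Proof.
move=> idI SI [n [a [g [Sg ->]]]].
by apply: ideal_sum => // i _; apply: ideal_mull => //; apply: SI.
Qed.

Lemma mem_ideal_gen S f : S f -> ideal_gen S f.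
Proof.
move=> Sf; exists 1%N, (fun=> 1), (fun=> f); split=> //.
by rewrite big_ord1 mul1r.
Qed.

Lemma ideal_gen_ideal S : is_ideal (ideal_gen S).
Proof.
split.
- exists 0%N, (fun=> 0), (fun=> 0); split; first by case.
  by rewrite big_ord0.
- move=> f1 f2 [n1 [a1 [g1 [Sg1 ->]]]] [n2 [a2 [g2 [Sg2 ->]]]].
  exists (n1 + n2)%N.
  exists (fun i => match split i with inl j => a1 j | inr j => a2 j end).
  exists (fun i => match split i with inl j => g1 j | inr j => g2 j end).
  split; first by move=> i; case: (split i).
  rewrite big_split_ord /=; congr (_ + _); apply: eq_bigr => i _.
    by rewrite (unsplitK (inl i)).
  by rewrite (unsplitK (inr i)).
- move=> b f [n [a [g [Sg ->]]]]; exists n, (fun i => b * a i), g; split=> //.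
  by rewrite mulr_sumr; apply: eq_bigr => i _; rewrite mulrA.
Qed.

Lemma mem_ideal_mul I J f g : I f -> J g -> ideal_mul I J (f * g).
Proof. by move=> If Jg; apply: mem_ideal_gen; exists f, g. Qed.

Lemma ideal_exp1 I f : is_ideal I -> ideal_exp I 1 f <-> I f.
Proof.
move=> idI; split; last first.
  by move=> If; rewrite -[f]mulr1; apply: mem_ideal_mul.
by apply: ideal_gen_min => // _ [g [h [Ig _ ->]]]; apply: ideal_mulr.
Qed.

Lemma mem_ideal_sq I f g : is_ideal I -> I f -> I g -> ideal_exp I 2 (f * g).
Proof. by move=> idI If Ig; apply: mem_ideal_mul => //; apply/ideal_exp1. Qed.

End Ideals.

(** * Derivations and Euler's relation *)

Definition derivation (R : comNzRingType) (D : R -> R) : Prop :=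
  (forall f g, D (f + g) = D f + D g) /\
  (forall f g, D (f * g) = D f * g + f * D g).

Section Derivations.
Variables (R : comNzRingType) (D : R -> R).
Hypothesis derD : derivation D.

Lemma derivation0 : D 0 = 0.
Proof.
by case: derD => DD _; apply: (addrI (D 0)); rewrite -DD !addr0.
Qed.

Lemma derivationN f : D (- f) = - D f.
Proof.
by case: derD => DD _; apply: (addIr (D f)); rewrite -DD !addNr derivation0.
Qed.

Lemma derivationB f g : D (f - g) = D f - D g.
Proof. by rewrite (proj1 derD) derivationN. Qed.

Lemma derivation1 : D 1 = 0.
Proof.
case: derD => _ DM; apply: (addrI (D 1)); rewrite addr0.
by rewrite -{3}[1]mulr1 DM mulr1 mul1r.
Qed.

Lemma derivationMn f n : D (f *+ n) = D f *+ n.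
Proof.
elim: n => [|n IHn]; first by rewrite !mulr0n derivation0.
by rewrite !mulrS (proj1 derD) IHn.
Qed.

End Derivations.

Definition pencil (R : comNzRingType) (X Y : R) (bs : seq R) : R :=
  \prod_(b <- bs) (Y - b * X).

(** The [d]-th power of the ideal generated by [X] and [Y]. *)
Fixpoint power_ideal2 (R : comNzRingType) (X Y : R) (d : nat) (f : R) : Prop :=
  if d is d'.+1 then
    exists a b, [/\ power_ideal2 X Y d' a, power_ideal2 X Y d' b
                  & f = X * a + Y * b]
  else True.

Section PowerIdeal.
Variables (R : comNzRingType) (X Y : R).

Lemma power_ideal2_ideal d : is_ideal (power_ideal2 X Y d).
Proof.
elim: d => [|d [m0 mD mM]]; first by [].
split=> [|f g|c f].
- by exists 0, 0; rewrite !mulr0 addr0.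
- move=> [a [b [ma mb ->]]] [a' [b' [ma' mb' ->]]].
  by exists (a + a'), (b + b'); split; [exact: mD | exact: mD | ring].
- move=> [a [b [ma mb ->]]].
  by exists (c * a), (c * b); split; [exact: mM | exact: mM | ring].
Qed.

Lemma power_ideal2S d f : power_ideal2 X Y d.+1 f -> power_ideal2 X Y d f.
Proof.
elim: d f => [//|d IHd] f [a [b [/IHd ma /IHd mb ->]]].
by exists a, b.
Qed.

Lemma power_ideal2_leq d e f :
  (d <= e)%N -> power_ideal2 X Y e f -> power_ideal2 X Y d f.
Proof.
move=> /subnK <-; elim: (e - d)%N => [//|n IHn].
by move/power_ideal2S/IHn.
Qed.

Lemma derivation_power_ideal2 (D : R -> R) d f :
  derivation D -> power_ideal2 X Y d.+1 f -> power_ideal2 X Y d (D f).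
Proof.
move=> [DD DM]; elim: d f => [//|d IHd] f [a [b [ma mb ->]]].
have idm := power_ideal2_ideal d.+1.
rewrite DD !DM; apply: (ideal_add idm); apply: (ideal_add idm).
- exact: (ideal_mull _ idm).
- exists (D a), 0; split; [exact: IHd | exact: ideal_zero (power_ideal2_ideal d)|].
  by rewrite mulr0 addr0.
- exact: (ideal_mull _ idm).
- exists 0, (D b); split; [exact: ideal_zero (power_ideal2_ideal d)| exact: IHd |].
  by rewrite mulr0 add0r.
Qed.

Lemma pencil_power_ideal2 bs : power_ideal2 X Y (size bs) (pencil X Y bs).
Proof.
elim: bs => [//|b bs IHbs] /=.
exists (- b * pencil X Y bs), (pencil X Y bs); split=> //.
  exact: (ideal_mull _ (power_ideal2_ideal _)).
by rewrite /pencil big_cons; ring.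
Qed.

End PowerIdeal.

Section Euler.
Variables (R : comNzRingType) (X Y : R) (Dx Dy : R -> R).
Hypotheses (derx : derivation Dx) (dery : derivation Dy).
Hypotheses (DxX : Dx X = 1) (DxY : Dx Y = 0) (DyX : Dy X = 0) (DyY : Dy Y = 1).
Hypothesis DxyC : forall f, Dx (Dy f) = Dy (Dx f).

Lemma euler_pencil (bs : seq R) :
  (forall b, b \in bs -> Dx b = 0) -> (forall b, b \in bs -> Dy b = 0) ->
  X * Dx (pencil X Y bs) + Y * Dy (pencil X Y bs) =
  (size bs)%:R * pencil X Y bs.
Proof.
elim: bs => [|b bs IHbs] bx byy.
  by rewrite /pencil big_nil (derivation1 derx) (derivation1 dery) !mulr0 addr0 mul0r.
rewrite /pencil big_cons -/(pencil X Y bs) (proj2 derx) (proj2 dery).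
rewrite (derivationB derx) (derivationB dery) (proj2 derx) (proj2 dery).
rewrite DxX DxY DyX DyY (bx b) ?(byy b) ?mem_head //.
have IH : X * Dx (pencil X Y bs) =
    (size bs)%:R * pencil X Y bs - Y * Dy (pencil X Y bs).
  rewrite -IHbs ?addrK // => c c_bs; [apply: bx | apply: byy];
    by rewrite in_cons c_bs orbT.
rewrite !mulrDr [X * ((Y - b * X) * _)]mulrCA IH -natr1; ring.
Qed.

(** Differentiating Euler's relation once more gives it for the partial
    derivatives, with the degree lowered by one. *)
Lemma euler_partials (n : R) (F : R) : Dx n = 0 -> Dy n = 0 ->
  X * Dx F + Y * Dy F = n * F ->
  X * Dx (Dx F) + Y * Dx (Dy F) = (n - 1) * Dx F /\
  X * Dx (Dy F) + Y * Dy (Dy F) = (n - 1) * Dy F.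
Proof.
move=> Dxn Dyn euler; split.
  have := congr1 Dx euler.
  rewrite (proj1 derx) !(proj2 derx) DxX DxY Dxn !mul0r mul1r !add0r.
  by move=> e; rewrite mulrBl -e; ring.
have := congr1 Dy euler.
rewrite (proj1 dery) !(proj2 dery) DyX DyY Dyn -DxyC !mul0r mul1r !add0r.
by move=> e; rewrite mulrBl -e; ring.
Qed.

End Euler.

Definition hessian (R : comNzRingType) (Dx Dy : R -> R) (F : R) : R :=
  Dx (Dx F) * Dy (Dy F) - Dx (Dy F) ^+ 2.

(** Here [u], [v] stand for the first and [A], [B], [C] for the second partial
    derivatives of a form [F] of degree [n]. Multiplying by [(n - 1) ^+ 2] allows
    Euler's relations for [u] and [v] to be substituted in the quadratic form;
    the determinant [A * C - B ^+ 2] then splits off, and the cofactor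
    [A * X ^+ 2 + 2 * B * X * Y + C * Y ^+ 2] is a multiple of [F] by Euler's
    relation again. *)
Lemma hessian_euler_sq (R : comNzRingType) (X Y n F u v A B C : R) :
  X * u + Y * v = n * F ->
  X * A + Y * B = (n - 1) * u -> X * B + Y * C = (n - 1) * v ->
  (n - 1) ^+ 2 * (C * u ^+ 2 - 2%:R * B * u * v + A * v ^+ 2) =
  (n - 1) * (n * F * (A * C - B ^+ 2)).
Proof.
move=> eF eu ev.
have -> : (n - 1) * (n * F * (A * C - B ^+ 2)) =
  (A * C - B ^+ 2) * (X * ((n - 1) * u) + Y * ((n - 1) * v)).
  by rewrite -eF; ring.
have -> : (n - 1) ^+ 2 * (C * u ^+ 2 - 2%:R * B * u * v + A * v ^+ 2) =
  C * ((n - 1) * u) ^+ 2 - 2%:R * B * ((n - 1) * u) * ((n - 1) * v)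
  + A * ((n - 1) * v) ^+ 2 by ring.
by rewrite -eu -ev; ring.
Qed.

(** * The hessian of the cone and the square of the Jacobian ideal *)

Section JacobianIdeal.
Variables (R : comNzRingType) (X Y Z : R) (Dx Dy Dz : R -> R).
Hypotheses (derx : derivation Dx) (dery : derivation Dy) (derz : derivation Dz).
Hypotheses (DxX : Dx X = 1) (DxY : Dx Y = 0) (DxZ : Dx Z = 0).
Hypotheses (DyX : Dy X = 0) (DyY : Dy Y = 1) (DyZ : Dy Z = 0).
Hypotheses (DzX : Dz X = 0) (DzY : Dz Y = 0) (DzZ : Dz Z = 1).
Hypothesis DxyC : forall f, Dx (Dy f) = Dy (Dx f).

Variables (J I : R -> Prop).
Hypotheses (idI : is_ideal I) (JI : forall f, J f -> I f).
Hypothesis Ixz : forall f g, J f -> J g -> I (Dx f * Dz g - Dz f * Dx g).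
Hypothesis Iyz : forall f g, J f -> J g -> I (Dy f * Dz g - Dz f * Dy g).

Variables (n : nat) (F K : R).
Hypotheses (n_ge6 : (6 <= n)%N) (Fn : power_ideal2 X Y n F) (DzF : Dz F = 0).
Hypothesis eulerF : X * Dx F + Y * Dy F = n%:R * F.
Hypotheses (J_YZ : J (Y * Z)) (J_cubic : J (Z * X ^+ 2 - Z ^+ 2 * X)).
Hypothesis J_G : J (F - Z ^+ 2 * X ^+ 4 * K).

Let derE := (proj1 derx, proj1 dery, proj1 derz, proj2 derx, proj2 dery, proj2 derz,
  derivationN derx, derivationN dery, derivationN derz,
  DxX, DxY, DxZ, DyX, DyY, DyZ, DzX, DzY, DzZ, DzF, exprS, expr0,
  derivation1 derx, derivation1 dery, derivation1 derz).

(** The minor of the conic and the cubic is [Z * X ^+ 2 - 2 * Z ^+ 2 * X], and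
    the cubic itself turns it into [- Z ^+ 2 * X]. *)
Lemma jac_ZZX : I (Z ^+ 2 * X).
Proof.
have := Iyz J_YZ J_cubic; rewrite !derE => I1.
have := ideal_sub idI (JI J_cubic) I1; congr I; ring.
Qed.

Lemma jac_ZXX : I (Z * X ^+ 2).
Proof. by have := ideal_add idI (JI J_cubic) jac_ZZX; congr I; ring. Qed.

Lemma jac_XZ (f : R) : power_ideal2 X Y 1 f -> I (X * Z * f).
Proof.
move=> [a [b [_ _ ->]]].
have -> : X * Z * (X * a + Y * b) = a * (Z * X ^+ 2) + X * b * (Y * Z) by ring.
exact: ideal_add idI (ideal_mull _ idI jac_ZXX) (ideal_mull _ idI (JI J_YZ)).
Qed.

Let DxF_n : power_ideal2 X Y 1 (Dx F).
Proof.
apply: derivation_power_ideal2 => //.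
by apply: power_ideal2_leq Fn; apply: leq_trans n_ge6.
Qed.

Let DyF_n : power_ideal2 X Y 1 (Dy F).
Proof.
apply: derivation_power_ideal2 => //.
by apply: power_ideal2_leq Fn; apply: leq_trans n_ge6.
Qed.

(** Up to multiples of [Z ^+ 2 * X], the minors of [Y * Z] and of the corrected
    cone are [- Y * Dx F] and [- Y * Dy F]; those of the cubic give the products
    by [- X ^+ 2] in the same way, since [X * Z] times a partial derivative of
    [F] lies in [I]. *)
Lemma jac_Yx : I (Y * Dx F).
Proof.
have := Ixz J_YZ J_G; rewrite !derE => I1.
pose a := - Y * (4%:R * X ^+ 2 * K + X ^+ 3 * Dx K).
have := ideal_sub idI (ideal_opp idI I1) (ideal_mull a idI jac_ZZX); congr I.
by rewrite /a; ring.
Qed.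

Lemma jac_Yy : I (Y * Dy F).
Proof.
have := Iyz J_YZ J_G; rewrite !derE => I1.
pose a := - Y * X ^+ 3 * Dy K + X ^+ 3 * K *+ 2 + Z * X ^+ 3 * Dz K.
have := ideal_sub idI (ideal_opp idI I1) (ideal_mull a idI jac_ZZX); congr I.
by rewrite /a; ring.
Qed.

Lemma jac_XXx : I (X ^+ 2 * Dx F).
Proof.
have := Ixz J_cubic J_G; rewrite !derE => I1.
pose a := (X ^+ 2 - 2%:R * X * Z) * (4%:R * X ^+ 2 * K + X ^+ 3 * Dx K)
  - (2%:R * X - Z) * (2%:R * X ^+ 3 * K + Z * X ^+ 3 * Dz K).
have := ideal_add idI (ideal_add idI (ideal_opp idI I1)
  (ideal_mull 2%:R idI (jac_XZ DxF_n))) (ideal_mull a idI jac_ZZX); congr I.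
by rewrite /a; ring.
Qed.

Lemma jac_XXy : I (X ^+ 2 * Dy F).
Proof.
have := Iyz J_cubic J_G; rewrite !derE => I1.
pose a := (X ^+ 2 - 2%:R * X * Z) * X ^+ 3 * Dy K.
have := ideal_add idI (ideal_add idI (ideal_opp idI I1)
  (ideal_mull 2%:R idI (jac_XZ DyF_n))) (ideal_mull a idI jac_ZZX); congr I.
by rewrite /a; ring.
Qed.

Lemma jac_power_ideal2 (w : R) : I (Y * w) -> I (X ^+ 2 * w) ->
  forall f, power_ideal2 X Y 2 f -> I (f * w).
Proof.
move=> IY IX f [a [b [[a' [b' [_ _ ->]]] _ ->]]].
have -> : (X * (X * a' + Y * b') + Y * b) * w =
  a' * (X ^+ 2 * w) + (X * b' + b) * (Y * w) by ring.
by apply: ideal_add idI _ _; apply: ideal_mull.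
Qed.

(** Each of the two factors [w1] and [w2] absorbs two of the four factors [X]
    or [Y] to become an element of [I]. *)
Lemma jac_sq_power_ideal2 (w1 w2 : R) :
  I (Y * w1) -> I (X ^+ 2 * w1) -> I (Y * w2) -> I (X ^+ 2 * w2) ->
  forall f, power_ideal2 X Y 4 f -> ideal_exp I 2 (f * (w1 * w2)).
Proof.
move=> IY1 IX1 IY2 IX2 f [a [b [[a1 [b1 [ma1 mb1 ->]]] mb ->]]].
have idII : is_ideal (ideal_exp I 2) by apply: ideal_gen_ideal.
have -> : (X * (X * a1 + Y * b1) + Y * b) * (w1 * w2) =
  (X ^+ 2 * w1) * (a1 * w2) + (Y * w1) * ((X * b1 + b) * w2) by ring.
apply: (ideal_add idII); apply: mem_ideal_sq => //.
  exact: jac_power_ideal2.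
apply: jac_power_ideal2 => //; apply: (ideal_add (power_ideal2_ideal _ _ 2)).
  exact: (ideal_mull _ (power_ideal2_ideal _ _ 2)).
exact: power_ideal2S.
Qed.

(** The second partial derivatives of [F] lie in the power [n - 2 >= 4] of the
    ideal of [X] and [Y], so the quadratic form of [hessian_euler_sq] is in the
    square of [I]; the correction term is a multiple of [(Z * X ^+ 2) ^+ 2]. *)
Lemma jac_sq_hessian :
  ideal_exp I 2 ((F - Z ^+ 2 * X ^+ 4 * K) *
                 ((n%:R - 1) * n%:R * hessian Dx Dy F)).
Proof.
have idII : is_ideal (ideal_exp I 2) by apply: ideal_gen_ideal.
have m4 D D' : derivation D -> derivation D' -> power_ideal2 X Y 4 (D (D' F)).
  move=> dD dD'; do 2!apply: derivation_power_ideal2 => //.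
  exact: power_ideal2_leq n_ge6 Fn.
have Dn (D : R -> R) : derivation D -> D n%:R = 0.
  by move=> dD; rewrite derivationMn // derivation1 // mul0rn.
have [eu ev] := euler_partials derx dery DxX DxY DyX DyY DxyC (Dn _ derx)
  (Dn _ dery) eulerF.
have := hessian_euler_sq eulerF eu ev; rewrite -/(hessian Dx Dy F).
set q := (_ ^+ 2 * _) => e.
have {}e : n%:R * F * hessian Dx Dy F * (n%:R - 1) = q by rewrite e mulrC.
have -> : (F - Z ^+ 2 * X ^+ 4 * K) * ((n%:R - 1) * n%:R * hessian Dx Dy F) =
  q - K * (n%:R - 1) * n%:R * hessian Dx Dy F * ((Z * X ^+ 2) * (Z * X ^+ 2)).
  by rewrite -e; ring.
apply: (ideal_sub idII); last first.
  by apply: ideal_mull => //; apply: mem_ideal_sq => //; apply: jac_ZXX.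
have -> : q = (n%:R - 1) ^+ 2 * (Dy (Dy F) * (Dx F * Dx F)
    - 2%:R * (Dx (Dy F) * (Dx F * Dy F)) + Dx (Dx F) * (Dy F * Dy F)).
  by rewrite /q; ring.
apply/(ideal_mull _ idII)/(ideal_add idII); first apply: (ideal_sub idII).
- by apply: jac_sq_power_ideal2; auto using jac_Yx, jac_XXx.
- apply: (ideal_mull _ idII).
  by apply: jac_sq_power_ideal2; auto using jac_Yx, jac_XXx, jac_Yy, jac_XXy.
- by apply: jac_sq_power_ideal2; auto using jac_Yy, jac_XXy.
Qed.

End JacobianIdeal.

(** * Binary forms *)

Section BinaryForms.
Variable k : fieldType.
Local Notation S := {poly {poly k}}.
Implicit Types (f g : S) (bs : seq k).

Definition dS (f : S) : S := map_poly (fun c : {poly k} => c^`()) f.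
Definition dT (f : S) : S := f^`().

Lemma coef_dS f i : (dS f)`_i = (f`_i)^`().
Proof. by rewrite coef_map_id0 // deriv0. Qed.

Lemma derivation_dT : derivation dT.
Proof. by split=> f g; [exact: derivD | exact: derivM]. Qed.

Lemma derivation_dS : derivation dS.
Proof.
split=> f g; apply/polyP=> i.
  by rewrite coefD !coef_dS coefD derivD.
rewrite coefD coef_dS !coefM raddf_sum -big_split /=.
by apply: eq_bigr => j _; rewrite !coef_dS derivM.
Qed.

Lemma dS_dT f : dS (dT f) = dT (dS f).
Proof.
by apply/polyP=> i; rewrite coef_dS !coef_deriv coef_dS derivMn.
Qed.

(* The variable [s] of the coefficient ring and the main variable [t]. *)
Local Notation s := (('X : {poly k})%:P : S).
Local Notation t := ('X : S).

(** Binary forms in [s] and [t] are seen as polynomials in [t] over the domain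
    [k[s]]. This one is monic in [t], with roots the multiples [b *: 'X] of [s],
    so that divisibility by it can be tested at these roots, for polynomials
    that need not be homogeneous. *)
Definition binform bs : S := pencil s t [seq b%:P%:P | b <- bs].

Lemma binformE bs : binform bs = \prod_(b <- bs) ('X - (b *: 'X)%:P).
Proof.
rewrite /binform /pencil big_map; apply: eq_bigr => b _.
by rewrite -polyCM mul_polyC.
Qed.

Lemma horner_binform bs (c : {poly k}) :
  (binform bs).[c] = \prod_(b <- bs) (c - b *: 'X).
Proof.
by rewrite binformE horner_prod; apply: eq_bigr => b _; rewrite hornerXsubC.
Qed.

(** The factor theorem splits off one root after the other: the differences of
    two roots are not units of [k[s]], but they are not zero divisors. *)
Lemma binform_dvd bs f : uniq bs ->
  (forall b, b \in bs -> f.[b *: 'X] = 0) -> exists g, f = binform bs * g.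
Proof.
rewrite binformE.
elim: bs f => [|b bs IHbs] f /=; first by exists f; rewrite big_nil mul1r.
move=> /andP[b_bs /IHbs {}IHbs] f0.
have /factor_theorem[g fE] : root f (b *: 'X) by apply/eqP/f0/mem_head.
have [c c_bs|h gE] := IHbs g.
  have /eqP : f.[c *: 'X] = 0 by apply: f0; rewrite in_cons c_bs orbT.
  rewrite fE hornerM hornerXsubC mulf_eq0 -scalerBl scaler_eq0 polyX_eq0 orbF.
  case/orP=> [/eqP//|]; rewrite subr_eq0 => /eqP cb.
  by rewrite -cb c_bs in b_bs.
by exists h; rewrite big_cons fE gE; ring.
Qed.

(** The product rule leaves only the product of the differences with the other
    roots. *)
Lemma horner_dT_binform_neq0 bs b :
  uniq bs -> b \in bs -> (dT (binform bs)).[b *: 'X] != 0.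
Proof.
move=> Ubs b_bs; rewrite binformE /dT (perm_big _ (perm_to_rem b_bs)) big_cons /=.
rewrite derivM derivXsubC mul1r hornerD hornerM hornerXsubC subrr mul0r addr0.
rewrite horner_prod prodf_seq_neq0; apply/allP=> c.
rewrite mem_rem_uniq // inE => /andP[c_b _] /=.
rewrite hornerXsubC -scalerBl scaler_eq0 polyX_eq0 orbF subr_eq0.
by rewrite eq_sym.
Qed.

Definition at_s0 (f : S) : {poly k} := map_poly (horner_eval 0) f.

Lemma at_s0_binform bs : at_s0 (binform bs) = 'X^(size bs).
Proof.
rewrite binformE /at_s0 rmorph_prod /=.
rewrite (eq_bigr (fun=> 'X)); last first.
  move=> b _; rewrite rmorphB /= map_polyX map_polyC /= horner_evalE.
  by rewrite hornerZ hornerX mulr0 subr0.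
by rewrite big_const_seq count_predT; elim: (size bs) => //= m ->; rewrite exprS.
Qed.


Lemma dS_s : dS s = 1.
Proof. by rewrite /dS map_polyC /= derivX. Qed.

Lemma dS_t : dS t = 0.
Proof.
apply/polyP=> i; rewrite coef_dS coefX coef0.
by case: (i == 1)%N; rewrite ?derivC ?deriv0 // -[1]/(1%:P) derivC.
Qed.

Lemma dS_const b : dS b%:P%:P = 0.
Proof. by rewrite /dS map_polyC /= derivC. Qed.

Lemma euler_binform bs :
  s * dS (binform bs) + t * dT (binform bs) = (size bs)%:R * binform bs.
Proof.
rewrite -(size_map (fun b => b%:P%:P) bs).
apply: euler_pencil; [exact: derivation_dS|exact: derivation_dT|exact: dS_s
  |exact: dS_t|exact: derivC|exact: derivX| |] => _ /mapP[b _ ->].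
  exact: dS_const.
by rewrite /dT derivC.
Qed.

(** The hessian is the Jacobian determinant of the regular sequence [u], [v] of
    the partial derivatives, hence generates the socle of the quotient by them.
    For binary forms there is a direct argument. If the hessian were
    [p * u + q * v], multiplying by [s ^+ 2] and using Euler's relations would
    show that [F] divides [v * W], for [W] a constant multiple of [v] plus a
    multiple of [s]. At the roots of [F] its derivative [v] does not vanish, so
    [F] divides [W]; but for [s = 0] the form [F] becomes [t ^+ n], and [W] a
    nonzero multiple of [t ^+ n.-1]. *)
Lemma hessian_notin_partials bs : [pchar k] =i pred0 -> uniq bs ->
  (2 <= size bs)%N -> forall p q : S,
  (((size bs)%:R - 1) * (size bs)%:R * hessian dS dT (binform bs)
     <> p * dS (binform bs) + q * dT (binform bs)).
Proof.
move=> char0 Ubs n_ge2 p q; have := euler_binform bs.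
have := horner_dT_binform_neq0 Ubs; have := at_s0_binform bs.
have := @binform_dvd bs _ Ubs.
set n := size bs in n_ge2 *; set F := binform bs; set u := dS F; set v := dT F.
move=> F_dvd F_s0 v_neq0 eF.
have Dn (D : S -> S) : derivation D -> D n%:R = 0.
  by move=> dD; rewrite derivationMn // derivation1 // mul0rn.
have [_ ev] := euler_partials derivation_dS derivation_dT dS_s dS_t
  (derivC _) (derivX _) dS_dT (Dn _ derivation_dS) (Dn _ derivation_dT) eF.
have [eu _] := euler_partials derivation_dS derivation_dT dS_s dS_t
  (derivC _) (derivX _) dS_dT (Dn _ derivation_dS) (Dn _ derivation_dT) eF.
rewrite -/u -/v in eu ev; rewrite /hessian -/u -/v.
set A := dS u in eu *; set B := dS v in eu ev *; set C := dT v in ev *.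
set kap := (_ - 1) * _ => eH.
pose W := s * (s * q - t * p) + kap * (n%:R - 1) ^+ 2 * v.
have vW : v * W = F * (kap * n%:R * (n%:R - 1) * C - s * p * n%:R).
  (* Euler's relations eliminate [A] and [B]. *)
  have e1 : s ^+ 2 * (A * C - B ^+ 2) =
    n%:R * (n%:R - 1) * F * C - ((n%:R - 1) * v) ^+ 2.
    have -> : n%:R * (n%:R - 1) * F * C =
      (s * ((n%:R - 1) * u) + t * ((n%:R - 1) * v)) * C.
      have -> : n%:R * (n%:R - 1) * F * C = (n%:R - 1) * (n%:R * F) * C by ring.
      by rewrite -eF; ring.
    by rewrite -eu -ev; ring.
  have e2 : s ^+ 2 * (kap * (A * C - B ^+ 2)) =
    kap * (n%:R * (n%:R - 1) * F * C - ((n%:R - 1) * v) ^+ 2).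
    by rewrite -e1; ring.
  have e3 : s * u = n%:R * F - t * v by rewrite -eF addrK.
  have e4 : s ^+ 2 * (p * u + q * v) = s * p * (n%:R * F - t * v) + s ^+ 2 * q * v.
    by rewrite -e3; ring.
  move: e2; rewrite eH e4 => e5.
  apply/eqP; rewrite -subr_eq0; apply/eqP.
  move/eqP: e5; rewrite -subr_eq0 => /eqP e5.
  by rewrite -[RHS]e5 /W; ring.
have [b b_bs|M WE] := F_dvd W.
  have : (v * W).[b *: 'X] = 0.
    rewrite vW hornerM horner_binform (perm_big _ (perm_to_rem b_bs)) big_cons /=.
    by rewrite subrr !mul0r.
  by rewrite hornerM => /eqP; rewrite mulf_eq0 (negPf (v_neq0 b b_bs)) => /eqP.
have nB1 (T : nzRingType) : n%:R - 1 = n.-1%:R :> T.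
  by rewrite -(@natrB T n 1) ?subn1 // ltnW.
have := congr1 at_s0 WE; rewrite /W /kap !nB1 /at_s0.
rewrite !(rmorphD, rmorphM, rmorphXn, rmorph_nat) /= -deriv_map -/(at_s0 F) F_s0.
rewrite map_polyC /= horner_evalE hornerX mul0r add0r derivXn.
have eN : n.-1%:R * n%:R * (n.-1%:R * n.-1%:R) * ('X^(n.-1) *+ n) =
    'X^(n.-1) *+ (n.-1 * n * (n.-1 * n.-1) * n) :> {poly k}.
  by rewrite -[RHS]mulr_natl -['X^_ *+ n]mulr_natl mulrA !natrM.
move/(etrans (esym eN)).
move/(congr1 (fun r : {poly k} => r`_n.-1)).
rewrite coefMn coefXn eqxx coefXnM ltn_predL (ltnW n_ge2) => /eqP.
rewrite (pcharf0P k).1 // !muln_eq0.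
by case: (n) n_ge2 => [|[|]].
Qed.

End BinaryForms.

(** * Linear forms, directional derivatives and restriction to a line *)

Lemma mpoly_ring_ind (n : nat) (R : comNzRingType) (P : {mpoly R[n]} -> Prop) :
  (forall c, P c%:MP) -> (forall i, P 'X_i) ->
  (forall f g, P f -> P g -> P (f + g)) ->
  (forall f g, P f -> P g -> P (f * g)) -> forall f, P f.
Proof.
move=> PC PX PD PM f; rewrite (mpolyE f).
apply: (big_ind P); [by rewrite -mpolyC0; apply: PC | exact: PD | move=> m _].
rewrite -mul_mpolyC; apply: (PM) => //; rewrite mpolyXE_id.
have P1 : P 1 by rewrite -mpolyC1; apply: PC.
apply: (big_ind P) => // i _.
by elim: (m i) => [|e IHe] //; rewrite exprS; apply: (PM).
Qed.

Section LinearForms.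
Variables (k : fieldType) (N : nat).
Implicit Types (f g : {mpoly k[N]}) (l : 'cV[k]_N) (v : 'rV[k]_N).

Definition lform l : {mpoly k[N]} := \sum_i l i 0 *: 'X_i.

Definition dirder v f : {mpoly k[N]} := \sum_i v 0 i *: f^`M(i).

Lemma lform_homog l : lform l \is 1.-homog.
Proof.
by apply: rpred_sum => i _; apply: rpredZ; rewrite dhomogX; apply/eqP/mdeg1.
Qed.

Lemma meval_lform l v : (lform l).@[v 0] = (v *m l) 0 0.
Proof.
rewrite mxE raddf_sum; apply: eq_bigr => i _ /=.
by rewrite mevalZ mevalXU mulrC.
Qed.

Lemma derivation_dirder v : derivation (dirder v).
Proof.
split=> f g; rewrite /dirder.
  by rewrite -big_split; apply: eq_bigr => i _; rewrite mderivD scalerDr.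
rewrite mulr_suml mulr_sumr -big_split; apply: eq_bigr => i _ /=.
by rewrite mderivM scalerDr scalerAl scalerAr.
Qed.

Lemma dirderC v c : dirder v c%:MP = 0.
Proof. by rewrite /dirder big1 // => i _; rewrite mderivC scaler0. Qed.

Lemma dirderX v i : dirder v 'X_i = (v 0 i)%:MP.
Proof.
rewrite /dirder (bigD1 i) //= big1 ?addr0 => [|j j_i]; rewrite mderivX mnm1E.
  have -> : (U_(i) - U_(i) = 0 :> 'X_{1..N})%MM.
    by apply/mnmP=> j; rewrite mnmBE subnn mnm0E.
  by rewrite eqxx scale1r mpolyX0 alg_mpolyC.
by rewrite eq_sym (negPf j_i) scale0r scaler0.
Qed.

Lemma dirderZ v c f : dirder v (c *: f) = c *: dirder v f.
Proof.
by rewrite -mul_mpolyC (proj2 (derivation_dirder v)) dirderC mul0r add0r mul_mpolyC.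
Qed.

Lemma dirder_lform v l : dirder v (lform l) = ((v *m l) 0 0)%:MP.
Proof.
rewrite /lform (big_morph _ (proj1 (derivation_dirder v)) (dirderC v 0)) mxE raddf_sum.
by apply: eq_bigr => i _; rewrite dirderZ dirderX -mul_mpolyC -mpolyCM mulrC.
Qed.

Lemma dirder_comm v w f : dirder v (dirder w f) = dirder w (dirder v f).
Proof.
rewrite /dirder.
under eq_bigr => i _ do rewrite (raddf_sum (mderiv i)) scaler_sumr /=.
under [RHS]eq_bigr => i _ do rewrite (raddf_sum (mderiv i)) scaler_sumr /=.
rewrite exchange_big; apply: eq_bigr => i _; apply: eq_bigr => j _.
by rewrite !mderivZ !scalerA mulrC mderiv_comm.
Qed.

End LinearForms.

Section Restriction.
Variables (k : fieldType) (a b : 'rV[k]_3).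
Local Notation S := {poly {poly k}}.
Implicit Types (f g : {mpoly k[3]}).

(** The restriction to the line through [a] and [b], parametrized by
    [s *: a + t *: b] where [s] is the variable of the coefficients. *)
Definition restr f : S :=
  mmap (polyC \o polyC) (fun i => (a 0 i *: 'X)%:P + (b 0 i)%:P%:P * 'X) f.

Lemma restrD f g : restr (f + g) = restr f + restr g.
Proof. exact: mmapD. Qed.

Lemma restrM f g : restr (f * g) = restr f * restr g.
Proof. exact: rmorphM. Qed.

Lemma restrC c : restr c%:MP = c%:P%:P.
Proof. exact: mmapC. Qed.

Lemma restrX i : restr 'X_i = (a 0 i *: 'X)%:P + (b 0 i)%:P%:P * 'X.
Proof. by rewrite /restr mmapX mmap1U. Qed.

Lemma restrZ c f : restr (c *: f) = c%:P%:P * restr f.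
Proof. by rewrite -mul_mpolyC restrM restrC. Qed.

Lemma restr_dirder_s f : restr (dirder a f) = dS (restr f).
Proof.
elim/mpoly_ring_ind: f => [c|i|f g IHf IHg|f g IHf IHg].
- by rewrite dirderC (restrC c) dS_const -mpolyC0 restrC.
- rewrite dirderX restrX (proj1 (derivation_dS k)) (proj2 (derivation_dS k)).
  rewrite dS_const dS_t mul0r mulr0 !addr0 restrC /dS map_polyC /=.
  by rewrite derivZ derivX alg_polyC.
- by rewrite (proj1 (derivation_dirder _)) !restrD IHf IHg (proj1 (derivation_dS k)).
- by rewrite (proj2 (derivation_dirder _)) restrD !restrM IHf IHg (proj2 (derivation_dS k)).
Qed.

Lemma restr_dirder_t f : restr (dirder b f) = dT (restr f).
Proof.
elim/mpoly_ring_ind: f => [c|i|f g IHf IHg|f g IHf IHg].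
- by rewrite dirderC (restrC c) /dT derivC -mpolyC0 restrC.
- by rewrite dirderX restrX /dT !derivE restrC; ring.
- by rewrite (proj1 (derivation_dirder _)) !restrD IHf IHg /dT derivD.
- by rewrite (proj2 (derivation_dirder _)) restrD !restrM IHf IHg /dT derivM.
Qed.

Lemma restr_lform (l : 'cV[k]_3) :
  restr (lform l) = ((a *m l) 0 0 *: 'X)%:P + ((b *m l) 0 0)%:P%:P * 'X.
Proof.
rewrite /lform (big_morph restr restrD (restrC 0)) !mxE.
rewrite scaler_suml !raddf_sum mulr_suml -big_split; apply: eq_bigr => i _ /=.
by rewrite restrZ restrX -!mul_polyC !polyCM; ring.
Qed.

(** Putting [t = c *: s] evaluates [f] along all the multiples of the vector
    [a + c *: b], that is, at all the coordinate vectors of one point. *)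
Lemma horner_restr f (c : k) :
  (restr f).[c *: 'X] = mmap polyC (fun i => (a + c *: b) 0 i *: 'X) f.
Proof.
elim/mpoly_ring_ind: f => [e|i|f g IHf IHg|f g IHf IHg].
- by rewrite restrC hornerC mmapC.
- rewrite restrX !hornerE mmapX mmap1U !mxE mul_polyC scalerA scalerDl.
  by rewrite [c * _]mulrC.
- by rewrite restrD hornerD IHf IHg mmapD.
- by rewrite restrM hornerM IHf IHg rmorphM.
Qed.

End Restriction.

Lemma mmap_homog (k : fieldType) (n d : nat) (f : {mpoly k[n]}) (y : 'I_n -> k)
    (p : {poly k}) :
  f \is d.-homog -> mmap polyC (fun i => y i *: p) f = f.@[y] *: p ^+ d.
Proof.
move=> /dhomogP f_d; rewrite mevalE /mmap scaler_suml big_seq [RHS]big_seq.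
apply: eq_bigr => m /f_d /= md; have <- : mdeg m = d by [].
rewrite mul_polyC -scalerA; congr (_ *: _).
rewrite /mmap1 mdegE -prodrXr -scaler_prod.
by apply: eq_bigr => i _; rewrite exprZn.
Qed.

(** * The vanishing ideal and its Jacobian ideal *)

Lemma mem_vanishing_ideal (k : fieldType) (s d : nat) (X : 'I_s -> 'rV[k]_3) f :
  f \is d.-homog -> (forall i, f.@[X i 0] = 0) -> vanishing_ideal X f.
Proof. by move=> f_d f0; apply: mem_ideal_gen; split=> //; exists d. Qed.

(** A form vanishing at a point vanishes at all its coordinate vectors, so its
    restriction has the whole ray [t = c *: s] over the point as a root. *)
Lemma restr_vanishing_ideal (k : fieldType) (s : nat) (X : 'I_s -> 'rV[k]_3)
    (a b : 'rV[k]_3) (bs : seq k) :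
  uniq bs -> (forall c, c \in bs -> exists i e, a + c *: b = e *: X i) ->
  forall f, vanishing_ideal X f -> exists h, restr a b f = binform bs * h.
Proof.
move=> Ubs onX f Jf; apply: binform_dvd => // c /onX[i [e abE]].
apply: (@ideal_gen_min _ _ (fun f => (restr a b f).[c *: 'X] = 0) f _ _ Jf)
  => {f Jf} [|f [[d f_d] f0]].
  split=> [|f g f0 g0|g f f0]; first by rewrite -mpolyC0 restrC hornerC.
    by rewrite restrD hornerD f0 g0 addr0.
  by rewrite restrM hornerM f0 mulr0.
rewrite horner_restr abE.
have -> : mmap polyC (fun j => (e *: X i) 0 j *: 'X) f =
          mmap polyC (fun j => X i 0 j *: (e *: 'X)) f.
  by apply: eq_bigr => m _; congr (_ * _); apply: mmap1_eq => j;
     rewrite mxE scalerA mulrC.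
by rewrite (mmap_homog _ _ f_d) f0 scale0r.
Qed.

Lemma sum_I3 (V : nmodType) (F : 'I_3 -> V) :
  \sum_j F j = F 0 + F 1 + F 2%:R.
Proof.
rewrite !big_ord_recl big_ord0 addr0 addrA.
by congr (_ + _ + _); congr F; apply: val_inj.
Qed.

Lemma det_mx22 (R : comNzRingType) (A : 'M[R]_2) :
  \det A = A 0 0 * A 1 1 - A 0 1 * A 1 0.
Proof.
rewrite (expand_det_row _ 0) !big_ord_recl big_ord0 addr0 /cofactor.
rewrite !det_mx11 !mxE /= expr0 expr1 mul1r mulN1r mulrN.
by do 2?congr (_ - _); congr (_ * _); congr (A _ _); apply: val_inj.
Qed.

Section JacobianIdeals.
Variables (k : fieldType) (J : {mpoly k[3]} -> Prop) (m : nat).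
Variable g : 'I_m -> {mpoly k[3]}.
Hypothesis genJ : homogeneous_generators J g.
Local Notation I := (jacobian_ideal J g).

Let idI : is_ideal I. Proof. exact: ideal_gen_ideal. Qed.

Let J_sub f : J f -> I f.
Proof. by move=> Jf; apply: mem_ideal_gen; left. Qed.

Let J_g i : J (g i).
Proof. by apply/(proj2 genJ)/mem_ideal_gen; exists i. Qed.

Definition minor2 (p q : 'I_3) (f h : {mpoly k[3]}) : {mpoly k[3]} :=
  f^`M(p) * h^`M(q) - f^`M(q) * h^`M(p).

Lemma det_jacobian2 (a : 'I_2 -> 'I_m) (b : 'I_2 -> 'I_3) :
  \det (mxsub a b (jacobian_matrix g)) =
  minor2 (b 0) (b 1) (g (a 0)) (g (a 1)).
Proof. by rewrite det_mx22 /minor2 !mxE. Qed.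

(** The other pairs of rows and columns reduce to increasing ones by a sign. *)
Lemma minor2_gens p q i j : I (minor2 p q (g i) (g j)).
Proof.
have core (p' q' : 'I_3) (i' j' : 'I_m) : (p' < q')%N -> (i' < j')%N ->
    I (minor2 p' q' (g i') (g j')).
  move=> pq ij; apply: mem_ideal_gen; right; apply: mem_ideal_gen.
  exists (fun o => if o == 0 then i' else j'), (fun o => if o == 0 then p' else q').
  split; last by rewrite det_jacobian2.
    by case=> [[|[|]] ?] // [[|[|]] ?].
  by case=> [[|[|]] ?] // [[|[|]] ?].
have I0 : I 0 by apply: ideal_zero.
case: (ltngtP p q) => [pq|qp|/val_inj ->]; last by rewrite /minor2 subrr.
  case: (ltngtP i j) => [ij|ji|/val_inj ->]; first exact: core.
    by have := ideal_opp idI (core _ _ _ _ pq ji); congr I; rewrite /minor2; ring.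
  by have := I0; congr I; rewrite /minor2; ring.
case: (ltngtP i j) => [ij|ji|/val_inj ->].
- by have := ideal_opp idI (core _ _ _ _ qp ij); congr I; rewrite /minor2; ring.
- by have := core _ _ _ _ qp ji; congr I; rewrite /minor2; ring.
- by have := I0; congr I; rewrite /minor2; ring.
Qed.

(** Modulo [J], the gradient of a combination of elements of [J] is the same
    combination of their gradients. *)
Lemma minor2_ideal (P : {mpoly k[3]} -> Prop) p q h :
  J h -> (forall f, P f -> J f) -> (forall f, P f -> I (minor2 p q f h)) ->
  forall f, ideal_gen P f -> I (minor2 p q f h).
Proof.
move=> Jh PJ PI f [n [a [e [Pe ->]]]].
rewrite /minor2 !raddf_sum !mulr_suml -sumrB; apply: ideal_sum => // i _ /=.
rewrite !mderivM.
have := ideal_add idI (ideal_mull (a i) idI (PI _ (Pe i)))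
  (ideal_mull ((a i)^`M(p) * h^`M(q) - (a i)^`M(q) * h^`M(p)) idI (J_sub (PJ _ (Pe i)))).
by congr I; rewrite /minor2; ring.
Qed.

Lemma minor2_in p q f h : J f -> J h -> I (minor2 p q f h).
Proof.
have Jgen e : (exists i, e = g i) -> J e by case=> i ->.
move=> Jf Jh; apply: (minor2_ideal Jh Jgen); last exact/(proj2 genJ).
move=> _ [i ->].
have -> : minor2 p q (g i) h = minor2 q p h (g i) by rewrite /minor2; ring.
apply: (minor2_ideal (J_g i) Jgen); last exact/(proj2 genJ).
by move=> _ [j ->]; apply: minor2_gens.
Qed.

Lemma dirder_minor_in (v w : 'rV[k]_3) f h : J f -> J h ->
  I (dirder v f * dirder w h - dirder w f * dirder v h).
Proof.
move=> Jf Jh.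
have -> : dirder v f * dirder w h - dirder w f * dirder v h =
    \sum_p \sum_q (v 0 p * w 0 q)%:MP * minor2 p q f h.
  have E u u' e e' : dirder u e * dirder u' e' =
      \sum_p \sum_q (u 0 p * u' 0 q)%:MP * (e^`M(p) * e'^`M(q)).
    rewrite /dirder mulr_suml; apply: eq_bigr => p _.
    rewrite mulr_sumr; apply: eq_bigr => q _.
    by rewrite -!mul_mpolyC mpolyCM; ring.
  rewrite !E [X in _ - X]exchange_big -sumrB; apply: eq_bigr => p _.
  rewrite -sumrB; apply: eq_bigr => q _.
  by rewrite /minor2 [w 0 q * _]mulrC; ring.
apply: ideal_sum => // p _; apply: ideal_sum => // q _.
by apply: ideal_mull => //; apply: minor2_in.
Qed.

End JacobianIdeals.

Definition combination (R : comNzRingType) (u v f : R) : Prop :=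
  exists p q, f = p * u + q * v.

Lemma combination_ideal (R : comNzRingType) (u v : R) : is_ideal (combination u v).
Proof.
split=> [|_ _ [p [q ->]] [p' [q' ->]]|c _ [p [q ->]]].
- by exists 0, 0; rewrite !mul0r addr0.
- by exists (p + p'), (q + q'); ring.
- by exists (c * p), (c * q); ring.
Qed.

(** Euler's relation puts the form of the points in the ideal of its partial
    derivatives [u] and [v]. Differentiating [restr f = binform bs * h] shows
    that the derivatives of [f] along the line also restrict into this ideal.
    Modulo it, the gradients of all elements of [J] are therefore multiples of
    the equation of the line, and their 2 x 2 minors vanish. *)
Lemma restr_jacobian_ideal (k : fieldType) (J : {mpoly k[3]} -> Prop) (m : nat)
    (g : 'I_m -> {mpoly k[3]}) (M : 'M[k]_3) (bs : seq k) :
  homogeneous_generators J g -> M \in unitmx -> (size bs)%:R != 0 :> k ->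
  let a := row 0 M in let b := row 1 M in
  (forall f, J f -> exists h, restr a b f = binform bs * h) ->
  forall f, jacobian_ideal J g f ->
    combination (dS (binform bs)) (dT (binform bs)) (restr a b f).
Proof.
move=> genJ Mu n_neq0 a b JF.
set F := binform bs in JF *; set u := dS F; set v := dT F.
have idK := combination_ideal u v.
have KF : combination u v F.
  have := euler_binform bs; rewrite -/F -/u -/v => e.
  exists (((size bs)%:R^-1)%:P%:P * 'X%:P), (((size bs)%:R^-1)%:P%:P * 'X).
  rewrite -!mulrA -mulrDr e mulrA.
  suff -> : ((size bs)%:R^-1)%:P%:P * (size bs)%:R = 1 :> {poly {poly k}}.
    by rewrite mul1r.
  have -> : (size bs)%:R = (size bs)%:R%:P%:P :> {poly {poly k}}.
    by rewrite !polyC_natr.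
  by rewrite -!polyCM mulVf.
have KJ f : J f -> combination u v (restr a b f).
  by move=> /JF[h ->]; exact: (ideal_mulr _ idK).
have Ka f : J f -> combination u v (restr a b (dirder a f)).
  move=> /JF[h e]; rewrite restr_dirder_s e (proj2 (derivation_dS k)).
  apply: (ideal_add idK); apply: (ideal_mulr _ idK) => //.
  by exists 1, 0; rewrite mul1r mul0r addr0.
have Kb f : J f -> combination u v (restr a b (dirder b f)).
  move=> /JF[h e]; rewrite restr_dirder_t e (proj2 (derivation_dT k)).
  apply: (ideal_add idK); apply: (ideal_mulr _ idK) => //.
  by exists 0, 1; rewrite mul1r mul0r add0r.
pose c := row 2%:R M; pose l i := (invmx M i 2%:R)%:P%:P : {poly {poly k}}.
have grad f (i : 'I_3) : J f -> exists e, combination u v e /\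
    restr a b f^`M(i) = e + l i * restr a b (dirder c f).
  move=> Jf.
  have fE : f^`M(i) = \sum_j invmx M i j *: dirder (row j M) f.
    under eq_bigr => j _ do rewrite /dirder scaler_sumr.
    rewrite exchange_big /= -[f^`M(i)]scale1r.
    have E p : (\sum_j invmx M i j * M j p) = (i == p)%:R.
      by move/matrixP: (mulVmx Mu) => /(_ i p); rewrite !mxE.
    under eq_bigr => p _.
      under eq_bigr => j _ do rewrite mxE scalerA.
      rewrite -scaler_suml E.
      over.
    rewrite (bigD1 i) //= eqxx big1 ?addr0 // => p; rewrite eq_sym => /negPf ->.
    by rewrite scale0r.
  rewrite fE sum_I3 !restrD !restrZ.
  eexists; split; last by [].
  by apply: (ideal_add idK); apply: (ideal_mull _ idK); [apply: Ka | apply: Kb].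
have idR : is_ideal (fun f => combination u v (restr a b f)).
  split=> [|f1 f2 K1 K2|f1 f2 K2].
  - by rewrite -mpolyC0 restrC !polyC0; exact: (ideal_zero idK).
  - by rewrite restrD; apply: (ideal_add idK).
  - by rewrite restrM; apply: (ideal_mull _ idK).
have Jg i : J (g i) by apply/(proj2 genJ)/mem_ideal_gen; exists i.
move=> f0; rewrite /jacobian_ideal => If; apply: (ideal_gen_min idR _ If) => {f0 If} f [/KJ//|].
rewrite /minor_ideal => If; apply: (ideal_gen_min idR _ If) => {f If} _ [r [o [_ _ ->]]].
rewrite det_jacobian2 /minor2.
have [e0 [K0 E0]] := grad (g (r 0)) (o 0) (Jg _).
have [e1 [K1 E1]] := grad (g (r 0)) (o 1) (Jg _).
have [e2 [K2 E2]] := grad (g (r 1)) (o 0) (Jg _).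
have [e3 [K3 E3]] := grad (g (r 1)) (o 1) (Jg _).
have -> (f1 f2 : {mpoly k[3]}) : f1 - f2 = f1 + (- 1)%:MP * f2.
  by rewrite mpolyCN mpolyC1 mulN1r.
rewrite restrD !restrM restrC E0 E1 E2 E3.
set w0 := restr _ _ (dirder c (g (r 0))); set w1 := restr _ _ (dirder c (g (r 1))).
have -> : (e0 + l (o 0) * w0) * (e3 + l (o 1) * w1) +
    (-1)%:P%:P * ((e1 + l (o 1) * w0) * (e2 + l (o 0) * w1)) =
    (e3 + l (o 1) * w1) * e0 + l (o 0) * w0 * e3
    - ((e2 + l (o 0) * w1) * e1 + l (o 1) * w0 * e2).
  by rewrite !polyCN; ring.
apply: (ideal_sub idK); apply: (ideal_add idK); exact: (ideal_mull _ idK).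
Qed.

(** * The frame adapted to the configuration *)

Section Frames.
Variable k : fieldType.
Implicit Types (x y z : 'cV[k]_3) (u v P Q : 'rV[k]_3).

Definition frame x y z : 'M[k]_3 :=
  \matrix_(i, j) (if j == 0 then x i 0 else if j == 1 then y i 0 else z i 0).

Lemma mx11_eq0 (M : 'M[k]_1) : (M == 0) = (M 0 0 == 0).
Proof. by rewrite {1}[M]mx11_scalar -scalemx1 scaler_eq0 oner_eq0 orbF. Qed.

Lemma mul_frame v x y z (j : 'I_3) :
  (v *m frame x y z) 0 j =
  if j == 0 then (v *m x) 0 0 else if j == 1 then (v *m y) 0 0 else (v *m z) 0 0.
Proof.
rewrite !mxE; case: ifP => j0; last case: ifP => j1; rewrite ?mxE;
  by apply: eq_bigr => i _; rewrite !mxE ?j0 ?j1.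
Qed.

Lemma frame_ext x y z u v : frame x y z \in unitmx ->
  u *m x = v *m x -> u *m y = v *m y -> u *m z = v *m z -> u = v.
Proof.
move=> Mu ex ey ez; apply: (can_inj (mulmxK Mu)); apply/rowP=> j.
by rewrite !mul_frame ex ey ez.
Qed.

(** A linear relation between the three forms loses its [z]-term when evaluated
    at [P], then its [x]-term when evaluated at [Q]. *)
Lemma frame_unit x y z P Q :
  P *m x = 0 -> P *m y = 0 -> P *m z != 0 ->
  Q *m x != 0 -> Q *m y = 0 -> y != 0 -> frame x y z \in unitmx.
Proof.
move=> Px Py Pz Qx Qy y0; rewrite -unitmx_tr -row_free_unit.
apply: inj_row_free => v vM.
have lin : v 0 0 *: x + v 0 1 *: y + v 0 2%:R *: z = 0.
  by apply/colP=> i; move/rowP/(_ i): vM; rewrite !mxE sum_I3 !mxE /= => <-.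
have v2 : v 0 2%:R = 0.
  move/(congr1 (mulmx P)): (lin); rewrite !mulmxDr -!scalemxAr Px Py mulmx0.
  rewrite !scaler0 !add0r => /eqP; rewrite scaler_eq0 (negPf Pz) orbF.
  by move/eqP.
have v0 : v 0 0 = 0.
  move/(congr1 (mulmx Q)): (lin); rewrite v2 !mulmxDr -!scalemxAr Qy mulmx0.
  rewrite scale0r scaler0 !addr0 => /eqP; rewrite scaler_eq0 (negPf Qx) orbF.
  by move/eqP.
move: lin; rewrite v0 v2 !scale0r add0r addr0 => /eqP.
rewrite scaler_eq0 (negPf y0) orbF => /eqP v1.
apply/rowP=> j; rewrite mxE.
by case: j => [[|[|[|]]] j3] //; [rewrite -v0|rewrite -v1|rewrite -v2];
  congr (v _ _); apply: val_inj.
Qed.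

Lemma invmx_frame x y z (i : 'I_3) : frame x y z \in unitmx ->
  [/\ (row i (invmx (frame x y z)) *m x) 0 0 = (i == 0)%:R,
      (row i (invmx (frame x y z)) *m y) 0 0 = (i == 1)%:R
    & (row i (invmx (frame x y z)) *m z) 0 0 = (i == 2%:R)%:R].
Proof.
move=> Mu; set M := frame x y z in Mu *.
have E j : (row i (invmx M) *m M) 0 j = (i == j)%:R.
  by rewrite -row_mul mulVmx // !mxE.
by have := (E 0, E 1, E 2%:R); rewrite !mul_frame /= => -[[-> ->] ->].
Qed.

End Frames.

(** The form [y] cuts out the line through the two points off [z = 0]. The
    forms vanishing at the first of them and agreeing with [z] at the second
    are the [e' + a *: y] for some fixed [e']; each point of [z = 0] excludes at
    most one value of [a], because only the first point is a common zero of
    [e'] and [y], and the field is infinite. *)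
Lemma adapted_forms (k : closedFieldType) (s : nat) (X : 'I_s -> 'rV[k]_3)
    (z : 'cV[k]_3) (i1 i2 : 'I_s) :
  distinct_points X -> i1 != i2 -> X i1 *m z != 0 -> X i2 *m z != 0 ->
  exists x y : 'cV[k]_3,
    [/\ X i1 *m x = 0, X i2 *m x = X i2 *m z, X i1 *m y = 0, X i2 *m y = 0
      & y != 0] /\
    forall i, X i *m z = 0 -> X i *m x != 0.
Proof.
move=> [Xn0 Xd] i12 Pz Qz.
pose A := col_mx (X i1) (X i2).
have A_free : row_free A.
  apply: inj_row_free => v; rewrite -[v]hsubmxK mul_row_col.
  rewrite [lsubmx v]mx11_scalar [rsubmx v]mx11_scalar !mul_scalar_mx.
  set a := lsubmx _ _ _; set b := rsubmx _ _ _ => /eqP; rewrite addr_eq0 => /eqP ab.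
  have [a0|a0] := eqVneq a 0.
    move: ab; rewrite a0 scale0r => /eqP; rewrite eq_sym oppr_eq0 scaler_eq0.
    by rewrite (negPf (Xn0 _)) orbF => /eqP ->; rewrite raddf0 row_mx0.
  have [b0|b0] := eqVneq b 0.
    move: ab; rewrite b0 scale0r oppr0 => /eqP; rewrite scaler_eq0.
    by rewrite (negPf a0) (negPf (Xn0 _)).
  case: (Xd _ _ i12); exists (- (b / a)).
    by rewrite oppr_eq0 mulf_neq0 ?invr_neq0.
  by rewrite scaleNr mulrC -scalerA -scalerN -ab scalerA mulVf // scale1r.
have [e [Pe Qe]] : exists e : 'cV[k]_3, X i1 *m e = 0 /\ X i2 *m e = 1%:M.
  case/row_freeP: A_free => B; rewrite mul_col_mx -[B]hsubmxK !mul_mx_row.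
  rewrite -/(block_mx _ _ _ _) scalar_mx_block => /eq_block_mx[_ e1 _ e2].
  by exists (rsubmx B).
have [y [y0 Py Qy]] : exists y : 'cV[k]_3,
    [/\ y != 0, X i1 *m y = 0 & X i2 *m y = 0].
  have : kermx A^T != 0.
    by rewrite -mxrank_eq0 mxrank_ker mxrank_tr (eqP A_free).
  case/rowV0Pn => w /sub_kermxP wA w0; exists w^T.
  have : A *m w^T = 0 by rewrite -[A]trmxK -trmx_mul wA trmx0.
  rewrite mul_col_mx -col_mx0 => /eq_col_mx[-> ->].
  by split=> //; apply: contra w0 => /eqP w0; rewrite -[w]trmxK w0 trmx0.
pose c := (X i2 *m z) 0 0.
have c0 : c != 0 by rewrite -mx11_eq0.
have e_unit : frame e y z \in unitmx.
  by apply: (frame_unit Pe Py Pz _ Qy y0); rewrite Qe oner_neq0.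
pose p : {poly k} := \prod_(i | X i *m z == 0)
  ((c * (X i *m e) 0 0)%:P + ((X i *m y) 0 0)%:P * 'X).
have : p != 0.
  apply/prodf_neq0 => i /eqP Xz; apply/eqP => /polyP fac0.
  case/eqP: (Xn0 i); apply: (frame_ext e_unit); rewrite mul0mx //.
    apply/eqP; rewrite mx11_eq0; move: (fac0 0%N).
    rewrite coefD coefC coefMX coef0 /= addr0 => /eqP.
    by rewrite mulf_eq0 (negPf c0).
  apply/eqP; rewrite mx11_eq0; move: (fac0 1%N).
  by rewrite coefD coefC coefMX coefC coef0 /= add0r => ->.
case/closed_nonrootP => a; rewrite rootE horner_prod prodf_seq_neq0 => /allP pa.
exists (c *: e + a *: y), y; split.
  split=> //; rewrite mulmxDr -!scalemxAr ?Pe ?Py ?Qe ?Qy !scaler0 ?addr0 //.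
  by rewrite scalemx1 -mx11_scalar.
move=> i Xz; have := pa i (mem_index_enum _); rewrite Xz eqxx /= !hornerE.
have E (U V : 'M[k]_1) : (c *: U + a *: V) 0 0 = c * U 0 0 + V 0 0 * a.
  by rewrite !mxE [a * _]mulrC.
by rewrite mx11_eq0 mulmxDr -!scalemxAr E.
Qed.

Lemma meval_pencil (k : fieldType) (N : nat) (x y : 'cV[k]_N) (bs : seq k)
    (v : 'rV[k]_N) :
  (pencil (lform x) (lform y) [seq b%:MP | b <- bs]).@[v 0] =
  \prod_(b <- bs) ((v *m y) 0 0 - b * (v *m x) 0 0).
Proof.
rewrite /pencil big_map rmorph_prod /=; apply: eq_bigr => b _.
by rewrite mevalB mevalM mevalC !meval_lform.
Qed.

Lemma homog_pencil (k : fieldType) (N : nat) (x y : 'cV[k]_N) (bs : seq k) :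
  pencil (lform x) (lform y) [seq b%:MP | b <- bs] \is (size bs).-homog.
Proof.
rewrite /pencil big_map; elim: bs => [|b bs IHbs].
  by rewrite big_nil dhomog1.
rewrite big_cons /=; rewrite -[(size bs).+1]add1n; apply: dhomogM => //.
by rewrite mul_mpolyC; apply: rpredB; last apply: rpredZ; apply: lform_homog.
Qed.

(** * Configurations with two points off a line *)

Section TwoPointsOffALine.
Variables (k : closedFieldType) (s : nat) (X : 'I_s -> 'rV[k]_3).
Hypotheses (char0 : [pchar k] =i pred0) (s_ge8 : (8 <= s)%N).
Hypothesis distX : distinct_points X.
Variables (x y z : 'cV[k]_3) (i1 i2 : 'I_s).
Hypotheses (i12 : i1 != i2).
Hypothesis onL : forall i, (X i *m z == 0) = (i \notin [set i1; i2]).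
Hypotheses (Px : X i1 *m x = 0) (Qx : X i2 *m x = X i2 *m z).
Hypotheses (Py : X i1 *m y = 0) (Qy : X i2 *m y = 0) (y_neq0 : y != 0).
Hypothesis Xx : forall i, X i *m z = 0 -> X i *m x != 0.
Variables (m : nat) (g : 'I_m -> {mpoly k[3]}).
Local Notation J := (vanishing_ideal X).
Local Notation I := (jacobian_ideal J g).
Hypothesis gensJ : homogeneous_generators J g.

Let M := frame x y z.

Let Mu : M \in unitmx.
Proof.
have Pz : X i1 *m z != 0 by rewrite onL negbK set21.
have Qz : X i2 *m z != 0 by rewrite onL negbK set22.
by apply: (frame_unit Px Py Pz _ Qy); rewrite ?Qx.
Qed.

Let A := [set i | X i *m z == 0].

Definition slope i := (X i *m y) 0 0 / (X i *m x) 0 0.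
Definition slopes := [seq slope i | i <- enum A].

Let bs := slopes.
Let n := size bs.

Lemma x_neq0 i : i \in A -> (X i *m x) 0 0 != 0.
Proof. by rewrite inE -mx11_eq0 => /eqP/Xx. Qed.

Lemma size_slopes_ge6 : (6 <= n)%N.
Proof.
rewrite /n size_map -cardE /A.
have -> : [set i | X i *m z == 0] = ~: [set i1; i2].
  by apply/setP=> i; rewrite in_setC inE onL.
rewrite cardsCs setCK cards2 i12 card_ord; exact: (leq_sub2r 2 s_ge8).
Qed.

Let n_ge6 := size_slopes_ge6.

Lemma uniq_slopes : uniq bs.
Proof.
rewrite map_inj_in_uniq ?enum_uniq // => i j; rewrite !mem_enum => iA jA eij.
apply/eqP; apply: contraT => ij; case: (proj2 distX i j ij).
exists ((X i *m x) 0 0 / (X j *m x) 0 0).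
  by rewrite mulf_neq0 ?invr_neq0 ?x_neq0.
move: (x_neq0 iA) (x_neq0 jA) => xi xj.
apply: (frame_ext Mu); apply/rowP=> o; rewrite ord1 -scalemxAl [RHS]mxE.
- by rewrite divfK.
- rewrite -[LHS](divfK xi) -/(slope i) eij /slope.
  by rewrite mulrC mulrA mulrAC.
- by move: iA jA; rewrite !inE => /eqP -> /eqP ->; rewrite !mxE mulr0.
Qed.

Let fx := lform x.
Let fy := lform y.
Let fz := lform z.
Let a := row 0 (invmx M).
Let b := row 1 (invmx M).
Let c := row 2%:R (invmx M).

Let ax : [/\ (a *m x) 0 0 = 1, (a *m y) 0 0 = 0 & (a *m z) 0 0 = 0].
Proof. exact: invmx_frame 0 Mu. Qed.

Let bx : [/\ (b *m x) 0 0 = 0, (b *m y) 0 0 = 1 & (b *m z) 0 0 = 0].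
Proof. exact: invmx_frame 1 Mu. Qed.

Let cx : [/\ (c *m x) 0 0 = 0, (c *m y) 0 0 = 0 & (c *m z) 0 0 = 1].
Proof. exact: invmx_frame 2%:R Mu. Qed.

(** The cone over the points of the line, with vertex the first point off it. *)
Let F := pencil fx fy [seq e%:MP | e <- bs].

(* At the second point off the line, where [fx] and [fz] take a common value
   [w], the value of the cone is [lam * w ^+ n]. *)
Let lam := \prod_(e <- bs) - e.
Let K := lam%:MP * fx ^+ (n - 6).
Let G := F - fz ^+ 2 * fx ^+ 4 * K.

Lemma vanish_on_configuration d f :
  f \is d.-homog -> f.@[X i1 0] = 0 -> f.@[X i2 0] = 0 ->
  (forall i, i \in A -> f.@[X i 0] = 0) -> J f.
Proof.
move=> f_d f1 f2 fA; apply: mem_vanishing_ideal f_d _ => i.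
have [iA|] := boolP (i \in A); first exact: fA.
by rewrite inE onL negbK !inE => /orP[] /eqP ->.
Qed.

Let ev l i : (lform l).@[X i 0] = (X i *m l) 0 0.
Proof. exact: meval_lform. Qed.

Let evA i : i \in A -> fz.@[X i 0] = 0.
Proof. by rewrite inE => /eqP Xz; rewrite ev Xz mxE. Qed.

Let ev1 : fx.@[X i1 0] = 0 /\ fy.@[X i1 0] = 0.
Proof. by rewrite !ev Px Py mxE. Qed.

Let ev2 : fx.@[X i2 0] = fz.@[X i2 0] /\ fy.@[X i2 0] = 0.
Proof. by rewrite !ev Qx Qy [in X in _ /\ X]mxE. Qed.

Let homXn d (f : {mpoly k[3]}) : f \is 1.-homog -> f ^+ d \is d.-homog.
Proof. by move=> f1; have := dhomogMn d f1; rewrite mul1n. Qed.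

Lemma conic_in_J : J (fy * fz).
Proof.
have [ev1x ev1y] := ev1; have [ev2x ev2y] := ev2.
apply: (vanish_on_configuration (d := 2)).
- exact: dhomogM (lform_homog y) (lform_homog z).
- by rewrite mevalM ev1y mul0r.
- by rewrite mevalM ev2y mul0r.
- by move=> i iA; rewrite mevalM evA // mulr0.
Qed.

Lemma cubic_in_J : J (fz * fx ^+ 2 - fz ^+ 2 * fx).
Proof.
have homx := lform_homog x; have homz := lform_homog z.
have [ev1x ev1y] := ev1; have [ev2x ev2y] := ev2.
apply: (vanish_on_configuration (d := 3)).
- apply: rpredB; first exact: dhomogM homz (homXn 2%N homx).
  exact: dhomogM (homXn 2%N homz) homx.
- by rewrite !expr2 mevalB !mevalM ev1x !(mulr0, mul0r) subr0.
- by rewrite !expr2 mevalB !mevalM ev2x; ring.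
- by move=> i iA; rewrite !expr2 mevalB !mevalM evA // !(mulr0, mul0r) subr0.
Qed.

(** The subtracted term vanishes with [fz] on the line and with [fx] at the
    vertex of the cone; at the second point off the line it takes the same value
    as the cone. *)
Lemma corrected_cone_in_J : J G.
Proof.
have homx := lform_homog x; have homz := lform_homog z.
have [ev1x ev1y] := ev1; have [ev2x ev2y] := ev2.
have evF i : F.@[X i 0] = \prod_(e <- bs) (fy.@[X i 0] - e * fx.@[X i 0]).
  by rewrite meval_pencil; apply: eq_bigr => e _; rewrite !ev.
have n6 : (n = 2 + 4 + (n - 6))%N by rewrite -{1}(subnKC n_ge6).
apply: (vanish_on_configuration (d := n)).
- apply: rpredB; first exact: homog_pencil.
  have : fz ^+ 2 * fx ^+ 4 * K \is (2 + 4 + (n - 6)).-homog.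
    rewrite /K mul_mpolyC -scalerAr; apply: rpredZ.
    by apply: dhomogM (homXn _ homx); apply: dhomogM; apply: homXn.
  by rewrite -n6.
- rewrite mevalB evF !mevalM ev1x ev1y.
  rewrite (eq_bigr (fun=> 0)) => [|e _]; last by rewrite mulr0 subr0.
  rewrite big_const_seq count_predT -/n -(subnKC n_ge6) /= !mul0r.
  by rewrite !(mulr0, mul0r) subr0.
- rewrite mevalB evF ev2x ev2y /K !mevalM mevalC !rmorphXn /= ev2x.
  set w := fz.@[X i2 0].
  rewrite (eq_bigr (fun e => - e * w)) => [|e _]; last by rewrite add0r mulNr.
  have wn : w ^+ n = w ^+ 6 * w ^+ (n - 6) by rewrite -exprD subnKC.
  rewrite big_split /= -/lam big_const_seq count_predT -/n -Monoid.iteropE.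
  rewrite -/(w ^+ n) wn; set q := w ^+ (n - 6); ring.
- move=> i iA; rewrite mevalB evF !mevalM evA //.
  rewrite (perm_big _ (perm_to_rem (map_f slope _ : slope i \in bs))) ?mem_enum //.
  rewrite big_cons /= !ev /slope divfK ?x_neq0 // subrr.
  by rewrite !(mulr0, mul0r) subr0.
Qed.

Let H := hessian (dirder a) (dirder b) F.

Lemma cone_hessian_in_I2 : ideal_exp I 2 (G * ((n%:R - 1) * n%:R * H)).
Proof.
have [Aax Aay Aaz] := ax; have [Bbx Bby Bbz] := bx; have [Ccx Ccy Ccz] := cx.
have D1 (w : 'rV[k]_3) (l : 'cV[k]_3) : (w *m l) 0 0 = 1 -> dirder w (lform l) = 1.
  by move=> wl; rewrite dirder_lform wl mpolyC1.
have D0 (w : 'rV[k]_3) (l : 'cV[k]_3) : (w *m l) 0 0 = 0 -> dirder w (lform l) = 0.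
  by move=> wl; rewrite dirder_lform wl mpolyC0.
have bsC (v : 'rV[k]_3) e : e \in [seq e%:MP_[3] | e <- bs] -> dirder v e = 0.
  by case/mapP=> e' _ ->; apply: dirderC.
have eulerF : fx * dirder a F + fy * dirder b F = n%:R * F.
  rewrite /n -(size_map (fun e => e%:MP_[3]) bs).
  apply: euler_pencil; do ?[exact: derivation_dirder | exact: D0 | exact: D1].
  - by move=> e; apply: bsC.
  - by move=> e; apply: bsC.
have DcF : dirder c F = 0.
  have [_ cM] := derivation_dirder c.
  rewrite /F /pencil big_map; elim: (bs) => [|e es IHes].
    by rewrite big_nil -mpolyC1 dirderC.
  rewrite big_cons cM IHes (derivationB (derivation_dirder c)) cM dirderC.
  by rewrite !D0 // !(mul0r, mulr0, addr0, subr0).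
have Fn : power_ideal2 fx fy n F.
  by rewrite /n -(size_map (fun e => e%:MP_[3]) bs); apply: pencil_power_ideal2.
apply: (jac_sq_hessian (derivation_dirder a) (derivation_dirder b)
  (derivation_dirder c) (D1 _ _ Aax) (D0 _ _ Aay) (D0 _ _ Aaz) (D0 _ _ Bbx)
  (D1 _ _ Bby) (D0 _ _ Bbz) (D0 _ _ Ccx) (D0 _ _ Ccy) (D1 _ _ Ccz) _ _ _ _ _
  n_ge6 Fn DcF eulerF conic_in_J cubic_in_J corrected_cone_in_J).
- exact: dirder_comm.
- exact: ideal_gen_ideal.
- by move=> f Jf; apply: mem_ideal_gen; left.
- by move=> f h; apply: dirder_minor_in.
- by move=> f h; apply: dirder_minor_in.
Qed.

Lemma restr_J f : J f -> exists h, restr a b f = binform bs * h.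
Proof.
have [Aax Aay Aaz] := ax; have [Bbx Bby Bbz] := bx.
apply: restr_vanishing_ideal uniq_slopes _ f => _ /mapP[i iA ->].
rewrite mem_enum in iA; exists i, ((X i *m x) 0 0)^-1.
apply: (frame_ext Mu); apply/rowP=> o; rewrite ord1 mulmxDl -!scalemxAl.
- rewrite [LHS]mxE [X in _ + X]mxE [RHS]mxE Aax Bbx mulr0 addr0.
  by rewrite mulVf ?x_neq0.
- by rewrite [LHS]mxE [X in _ + X]mxE [RHS]mxE Aay Bby mulr1 add0r mulrC.
- rewrite [LHS]mxE [X in _ + X]mxE [RHS]mxE Aaz Bbz mulr0 addr0.
  by move: iA; rewrite inE => /eqP ->; rewrite [X in _ * X]mxE mulr0.
Qed.

Let u := dS (binform bs).
Let v := dT (binform bs).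

Lemma restr_J_mul_I f : ideal_mul J (ideal_exp I 1) f ->
  exists2 h, combination u v h & restr a b f = binform bs * h.
Proof.
have n_neq0 : (size bs)%:R != 0 :> k.
  by rewrite (pcharf0P k).1 // -/n -(subnKC n_ge6).
have u_inv : invmx M \in unitmx by rewrite unitmx_inv.
have IK := restr_jacobian_ideal gensJ u_inv n_neq0 restr_J.
have idK := combination_ideal u v.
move=> Pf; apply: (@ideal_gen_min _ _ (fun f => exists2 h,
  combination u v h & restr a b f = binform bs * h) _ _ _ Pf) => {f Pf};
  first split.
- by exists 0; [apply: (ideal_zero idK) | rewrite -mpolyC0 restrC !polyC0 mulr0].
- move=> f1 f2 [h1 K1 e1] [h2 K2 e2]; exists (h1 + h2).
    exact: (ideal_add idK).
  by rewrite restrD e1 e2 mulrDr.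
- move=> e f' [h Kh eh]; exists (restr a b e * h).
    exact: (ideal_mull _ idK).
  by rewrite restrM eh mulrCA.
- move=> _ [f1 [f2 [/restr_J[h e] If2 ->]]].
  have {}If2 : I f2 by apply/(ideal_exp1 _ (ideal_gen_ideal _)).
  exists (h * restr a b f2); first exact/(ideal_mull _ idK)/IK.
  by rewrite restrM e mulrA.
Qed.

Let restrN f : restr a b (- f) = - restr a b f.
Proof. by apply/eqP; rewrite -addr_eq0 -restrD addNr -mpolyC0 restrC !polyC0. Qed.

Lemma restr_cone : restr a b F = binform bs.
Proof.
have [Aax Aay _] := ax; have [Bbx Bby _] := bx.
rewrite /F /pencil binformE.
have r1 : restr a b 1 = 1 by rewrite -mpolyC1 restrC !polyC1.
rewrite (big_morph (restr a b) (restrM a b) r1) big_map; apply: eq_bigr => e _.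
rewrite restrD restrN restrM restrC !restr_lform Aax Aay Bbx Bby /=.
by rewrite -!mul_polyC !polyCM !polyC0 !polyC1; ring.
Qed.

Lemma restr_corrected_cone : restr a b G = binform bs.
Proof.
have [_ _ Aaz] := ax; have [_ _ Bbz] := bx.
rewrite /G restrD restrN !restrM restr_cone restr_lform Aaz Bbz /=.
by rewrite scale0r !polyC0 !(mul0r, addr0, mulr0, subr0).
Qed.

Lemma restr_hessian :
  restr a b ((n%:R - 1) * n%:R * H) =
  (n%:R - 1) * n%:R * hessian (@dS k) (@dT k) (binform bs).
Proof.
have restr_nat e : restr a b e%:R = e%:R.
  by rewrite -mpolyC_nat restrC !polyC_natr.
rewrite !restrM restrD restrN (restr_nat 1%N) restr_nat /H /hessian.
rewrite restrD restrN !restrM !(restr_dirder_s, restr_dirder_t) restr_cone.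
by rewrite expr2.
Qed.

(** The corrected cone times the hessian of the cone lies in [J] and in the
    square of [I]. If it were in [J * I], restricting to the line and cancelling
    the form of the points would put the hessian of this form in the ideal of
    its partial derivatives. *)
Lemma not_VV_torsion_free : ~ VV_torsion_free J I.
Proof.
move=> /(_ 2%N isT (G * ((n%:R - 1) * n%:R * H))) [VV _].
have [|h [p [q hE]] eh] := restr_J_mul_I (VV _).
  split; last exact: cone_hessian_in_I2.
  exact: (ideal_mulr _ (ideal_gen_ideal _) corrected_cone_in_J).
have F_neq0 : binform bs != 0.
  by rewrite binformE; apply/monic_neq0/monic_prod_XsubC.
have n_ge2 : (2 <= size bs)%N by apply: leq_trans n_ge6.
apply: (@hessian_notin_partials _ bs char0 uniq_slopes n_ge2 p q).
rewrite -hE; apply: (mulfI F_neq0); rewrite -eh restrM restr_corrected_cone.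
by rewrite restr_hessian.
Qed.

End TwoPointsOffALine.

Local Close Scope ring_scope.

Theorem theorem2p3 (k : closedFieldType) (char0 : [pchar k]%R =i pred0)
    (s : nat) (s_ge8 : 8 <= s) (X : 'I_s -> 'rV[k]_3)
    (configX : collinear_configuration 2 X)
    (m : nat) (g : 'I_m -> {mpoly k[3]})
    (gensJ : homogeneous_generators (vanishing_ideal X) g) :
  ~ VV_torsion_free (vanishing_ideal X) (jacobian_ideal (vanishing_ideal X) g).
Proof.
have [_ _ distX [z _ cardL]] := configX.
set L := [set i | _] in cardL.
have /cards2P[i1 [i2 [i12 LC]]] : #|~: L| == 2%N.
  by rewrite cardsCs setCK card_ord cardL subKn // (leq_trans _ s_ge8).
have onL i : (X i *m z == 0)%R = (i \notin [set i1; i2]).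
  by rewrite -LC inE negbK inE.
have Pz : (X i1 *m z != 0)%R by rewrite onL negbK set21.
have Qz : (X i2 *m z != 0)%R by rewrite onL negbK set22.
have [x [y [[Px Qx Py Qy y0] Xx]]] := adapted_forms distX i12 Pz Qz.
exact: (not_VV_torsion_free char0 s_ge8 distX i12 onL Px Qx Py Qy y0 Xx gensJ).
Qed.
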